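(* Let $\boldsymbol x_T=\sum_ts_t\boldsymbol1_{\mathcal C_t}$ be a finite convex combination of incidence vectors of bases $\mathcal C_t\in\mathcal B_B$ ($s_t\ge0$, $\sum_ts_t=1$). There is a deterministic sequence of feasible pairwise pipage endpoint moves, starting at $\boldsymbol x_T$, producing a base $\mathcal C^0\in\mathcal B_B$ (i.e. ending at the point $\boldsymbol 1_{\mathcal C^0}$) such that $$v(\mathcal C^0)\ \ge\ \widetilde v(\boldsymbol x_T).$$
   Context: Let $R\ge1$. For $r=1,\dots,R$ let $\mathbf U_r\in\mathbb R^{N_r\times K_r}$ have full column rank, with $i$th row $(\boldsymbol u_i^{(r)})^\top$, $\mathcal N_r=\{1,\dots,N_r\}$, $N_\Sigma=\sum_rN_r$. For $\mathcal S\subseteq\mathcal N_r$ put $F_r(\mathcal S)=\sum_{i,j\in\mathcal S}((\boldsymbol u_i^{(r)})^\top\boldsymbol u_j^{(r)})^2$, $Z_r=F_r(\mathcal N_r)$. Ground set $\mathcal E=\bigcup_r(\{r\}\times\mathcal N_r)$; for $\mathcal C\subseteq\mathcal E$, $\mathcal C_r=\{i:(r,i)\in\mathcal C\}$ and $v(\mathcal C)=1-\prod_rF_r(\mathcal N_r\setminus\mathcal C_r)/\prod_rZ_r$. Integers $\kappa_r$ with $K_r\le\kappa_r\le N_r$ and $L$ with $\sum_r\kappa_r\le L\le N_\Sigma$ are given; $B=N_\Sigma-L$ and $\mathcal B_B=\{\mathcal C\subseteq\mathcal E:|\mathcal C|=B,\ |\mathcal C_r|\le N_r-\kappa_r\ \forall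 r\}$. $\widetilde v:[0,1]^{\mathcal E}\to\mathbb R$ is the multilinear extension of $v$: $\widetilde v(\boldsymbol x)=\sum_{\mathcal C\subseteq\mathcal E}v(\mathcal C)\prod_{e\in\mathcal C}x_e\prod_{e\notin\mathcal C}(1-x_e)$. Let $P$ be the convex hull of $\{\boldsymbol1_{\mathcal C}:\mathcal C\in\mathcal B_B\}$, and $\boldsymbol e_i$ the standard basis vectors of $\mathbb R^{\mathcal E}$. A feasible pairwise pipage endpoint move at a non-integral $\boldsymbol x\in P$ chooses two distinct elements $i,j\in\mathcal E$ with fractional coordinates such that the set $\{\lambda:\boldsymbol x+\lambda(\boldsymbol e_i-\boldsymbol e_j)\in P\}=[\lambda_-,\lambda_+]$ has $\lambda_-<0<\lambda_+$, and replaces $\boldsymbol x$ by $\boldsymbol x+\lambda(\boldsymbol e_i-\boldsymbol e_j)$ with $\lambda\in\{\lambda_-,\lambda_+\}$. *)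

(* Defs.v *)
From HB Require Import structures.
From mathcomp Require Import all_boot all_order all_algebra.
From mathcomp Require Import boolp classical_sets set_interval reals convex.

Set Implicit Arguments.
Unset Strict Implicit.
Unset Printing Implicit Defensive.

Import Order.TTheory GRing.Theory Num.Theory.

Local Open Scope ring_scope.

(* The disjoint union of the sets {r} x {0, ..., N r - 1}. *)
Notation ground N := {r : 'I__ & 'I_(N r)}.

(* R^E; the alias R^o makes the scaling of the R-module structure available. *)
Notation vec R E := {ffun E -> R^o}.

Definition std_basis (R : realType) (E : finType) (i : E) : vec R E :=
  [ffun e => (e == i)%:R].

Definition incidence (R : realType) (E : finType) (C : {set E}) : vec R E :=
  [ffun e => (e \in C)%:R].

Definition convex_hull (R : realType) (V : lmodType R) (A : set V) : set V :=
  smallest (@convex_set R V) A.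

(* Total on R^E; meant for x in the cube [0, 1]^E. *)
Definition multilinear_ext (R : realType) (E : finType) (f : {set E} -> R)
    (x : vec R E) : R :=
  \sum_(C : {set E})
    f C * ((\prod_(e in C) x e) * \prod_(e in ~: C) (1 - x e)).

Definition frame_potential (R : realType) (N K : nat) (U : 'M[R]_(N, K))
    (S : {set 'I_N}) : R :=
  \sum_(i in S) \sum_(j in S) ((row i U *m (row j U)^T) 0 0) ^+ 2.

Definition block (n : nat) (N : 'I_n -> nat) (C : {set ground N}) (r : 'I_n) :
    {set 'I_(N r)} :=
  [set i : 'I_(N r) | Tagged (fun s => 'I_(N s)) i \in C].

(* The denominator vanishes only if some U r = 0; the value is then 1. *)
Definition value (R : realType) (n : nat) (N K : 'I_n -> nat)
    (U : forall r, 'M[R]_(N r, K r)) (C : {set ground N}) : R :=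
  1 - (\prod_(r < n) frame_potential (U r) (~: block C r))
      / \prod_(r < n) frame_potential (U r) [set: 'I_(N r)].

Definition bases (n : nat) (N kappa : 'I_n -> nat) (L : nat) :
    {set {set ground N}} :=
  [set C : {set ground N} | (#|C| == (\sum_(r < n) N r) - L)%N
    && [forall r, (#|block C r| <= N r - kappa r)%N]].

Definition base_polytope (R : realType) (n : nat) (N kappa : 'I_n -> nat)
    (L : nat) : set (vec R (ground N)) :=
  convex_hull [set incidence R C | C in [set` bases N kappa L]]%classic.
Arguments base_polytope R {n} N kappa L _.

(* Non-integrality of x is implied by the fractional coordinates i and j. *)
Definition pipage_move (R : realType) (E : finType) (P : set (vec R E))
    (x y : vec R E) : Prop :=
  P x /\
  exists (i j : E) (lm lp : R),
    [/\ i != j, 0 < x i < 1 & 0 < x j < 1] /\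
    [/\ [set l : R | P (x + l *: (std_basis R i - std_basis R j))]%classic
          = `[lm, lp]%classic,
        lm < 0 < lp
      & exists2 l : R, l = lm \/ l = lp
          & y = x + l *: (std_basis R i - std_basis R j)].

(* Main.v *)
(** The polytope is cut out of the cube by x(E) = B and by one integral
upper bound per block. At a non-integral point, take two fractional coordinates
in the same block if there are any; otherwise every block contains at most one
and, its bound being an integer, is slack enough to round that one up. Either
way only the cube constraints on the two coordinates bind along e_i - e_j, so
both endpoints have fewer fractional coordinates. This shows, by induction on
their number, both that the inequalities describe the hull of the bases and that
pipage terminates. A product of nonnegative monotone supermodular functions is
supermodular, so v is submodular and its multilinear extension is convex along
e_i - e_j: one of the two endpoints does not decrease it. *)

Require Import Defs.
From HB Require Import structures.
From mathcomp Require Import all_boot all_order all_algebra.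
From mathcomp Require Import boolp classical_sets set_interval reals convex.
From mathcomp Require Import interval_inference ring lra.

Set Implicit Arguments.
Unset Strict Implicit.
Unset Printing Implicit Defensive.

Import Order.TTheory GRing.Theory Num.Theory.

Local Open Scope ring_scope.

(** * Multilinear extensions, one coordinate at a time *)

Definition subset_weight (R : realType) (E : finType) (x : vec R E)
    (C : {set E}) (e : E) : R := if e \in C then x e else 1 - x e.

Lemma multilinear_extE (R : realType) (E : finType) (f : {set E} -> R)
    (x : vec R E) :
  multilinear_ext f x = \sum_C f C * \prod_e subset_weight x C e.
Proof.
apply: eq_bigr => C _; congr (_ * _).
rewrite [RHS](bigID (mem C)) /=; congr (_ * _).
  by apply: eq_bigr => e eC; rewrite /subset_weight eC.
by apply: eq_big => [e|e]; rewrite inE // /subset_weight => /negbTE->.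
Qed.

(** A set [D] other than [C] differs from [C] at some element, and the factor of that element is
    [0]. *)
Lemma multilinear_ext_incidence (R : realType) (E : finType)
    (f : {set E} -> R) (C : {set E}) :
  multilinear_ext f (incidence R C) = f C.
Proof.
rewrite multilinear_extE (bigD1 C) //= !big1 ?addr0 ?mulr1 //.
- move=> D; apply: contra_neq_eq => neq0; apply/setP => e.
  have: subset_weight (incidence R C) D e != 0.
    apply: contraNneq neq0 => w0; apply/eqP.
    by rewrite (bigD1 e) //= w0 mul0r mulr0.
  rewrite /subset_weight ffunE.
  by case: (e \in D); case: (e \in C) => //=; rewrite ?subrr ?eqxx.
- move=> e _; rewrite /subset_weight ffunE.
  by case: (e \in C); rewrite ?subr0.
Qed.

Lemma sum_subsets_split (R : realType) (E : finType) (i : E)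
    (F : {set E} -> R) :
  \sum_C F C = \sum_(C : {set E} | i \notin C) (F C + F (i |: C)).
Proof.
rewrite big_split /= (bigID (fun C : {set E} => i \in C)) /= addrC.
congr (_ + _).
rewrite (reindex_onto (fun C : {set E} => i |: C) (fun C => C :\ i)).
  apply: eq_bigl => C; rewrite setU11 /=.
  apply/eqP/idP => [<-|iC]; first by rewrite setD11.
  by rewrite setU1K.
by move=> C iC; rewrite finset.setD1K.
Qed.

(** Pairing [C] with [i |: C] leaves a common product free of [x i], so the dependence on [x i] is
    affine and explicit. *)
Lemma multilinear_ext_off (R : realType) (E : finType) (f : {set E} -> R)
    (x : vec R E) (i : E) :
  multilinear_ext f x =
  \sum_(C : {set E} | i \notin C)
    ((1 - x i) * f C + x i * f (i |: C))
      * \prod_(e | e != i) subset_weight x C e.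
Proof.
rewrite multilinear_extE (sum_subsets_split i); apply: eq_bigr => C iC.
rewrite (bigD1 i) //= [X in _ + _ * X](bigD1 i) //= {1 3}/subset_weight.
rewrite setU11 (negbTE iC).
rewrite [X in _ + _ * (_ * X)](eq_bigr (subset_weight x C)); first by ring.
by move=> e ei; rewrite /subset_weight in_setU1 (negbTE ei).
Qed.

Lemma multilinear_ext_split (R : realType) (E : finType) (f : {set E} -> R)
    (x : vec R E) (i : E) :
  multilinear_ext f x =
    (1 - x i) * multilinear_ext (fun C => f (C :\ i)) x
    + x i * multilinear_ext (fun C => f (i |: C)) x.
Proof.
rewrite !(multilinear_ext_off _ _ i) !big_distrr -big_split /=.
apply: eq_bigr => C iC.
rewrite setU1K // finset.setUA finset.setUid (_ : C :\ i = C); first by ring.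
apply/setP => e; rewrite in_setD1.
by have [->|//] := eqVneq e i; rewrite (negbTE iC).
Qed.

(** When [f] ignores [i], the weights [1 - x i] and [x i] of each pair add up to [1], and [x i]
    drops out. *)
Lemma multilinear_ext_ext_off (R : realType) (E : finType)
    (f : {set E} -> R) (x y : vec R E) (i : E) :
  (forall C, f (i |: C) = f C) -> (forall e, e != i -> x e = y e) ->
  multilinear_ext f x = multilinear_ext f y.
Proof.
move=> fi xy; rewrite !(multilinear_ext_off _ _ i); apply: eq_bigr => C iC.
rewrite fi -!mulrDl !subrK; congr (_ * _); apply: eq_bigr => e ei.
by rewrite /subset_weight xy.
Qed.

Lemma multilinear_ext_ge0 (R : realType) (E : finType) (f : {set E} -> R)
    (x : vec R E) :
  (forall C, 0 <= f C) -> (forall e, 0 <= x e <= 1) ->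
  0 <= multilinear_ext f x.
Proof.
move=> f0 x01; apply: sumr_ge0 => C _; rewrite mulr_ge0 ?mulr_ge0 //.
  by apply: prodr_ge0 => e _; have /andP[] := x01 e.
by apply: prodr_ge0 => e _; have /andP[_] := x01 e; rewrite subr_ge0.
Qed.

(** * Submodularity and convexity along an exchange direction *)

Definition submodular (R : realType) (E : finType) (f : {set E} -> R) :=
  forall A B : {set E}, f (A :|: B) + f (A :&: B) <= f A + f B.

Definition shift (R : realType) (E : finType) (i j : E) (x : vec R E) (l : R) :
  vec R E := x + l *: (std_basis R i - std_basis R j).

Lemma shiftE (R : realType) (E : finType) (i j : E) (x : vec R E) (l : R) e :
  shift i j x l e = x e + l * ((e == i)%:R - (e == j)%:R).
Proof. by rewrite !ffunE. Qed.

Lemma shift_src (R : realType) (E : finType) (i j : E) (x : vec R E) (l : R) :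
  i != j -> shift i j x l i = x i + l.
Proof. by move=> ij; rewrite shiftE eqxx (negbTE ij) subr0 mulr1. Qed.

Lemma shift_tgt (R : realType) (E : finType) (i j : E) (x : vec R E) (l : R) :
  i != j -> shift i j x l j = x j - l.
Proof.
by move=> ij; rewrite shiftE eqxx eq_sym (negbTE ij) sub0r mulrN1.
Qed.

Lemma shift_other (R : realType) (E : finType) (i j : E) (x : vec R E) (l : R)
  (e : E) : e != i -> e != j -> shift i j x l e = x e.
Proof.
by move=> /negbTE ei /negbTE ej; rewrite shiftE ei ej subrr mulr0 addr0.
Qed.

(* Along e_i - e_j the extension is a quadratic polynomial whose leading
   coefficient is minus a mixed second difference of f. *)
Lemma multilinear_ext_shift (R : realType) (E : finType) (f : {set E} -> R)
    (x : vec R E) (i j : E) :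
  submodular f -> (forall e, 0 <= x e <= 1) -> i != j ->
  exists2 q : R * R, 0 <= q.2 & forall l,
    multilinear_ext f (shift i j x l)
      = multilinear_ext f x + q.1 * l + q.2 * l ^+ 2.
Proof.
move=> fsub x01 ij; have ji : j != i by rewrite eq_sym.
(* The first digit forces the membership of [i], the second that of [j]; the extensions of these
   four functions then depend on neither coordinate. *)
pose f00 C := f ((C :\ j) :\ i); pose f01 C := f ((j |: C) :\ i).
pose f10 C := f (i |: (C :\ j)); pose f11 C := f (i |: (j |: C)).
have splitE y : multilinear_ext f y =
    (1 - y i) * ((1 - y j) * multilinear_ext f00 y
                 + y j * multilinear_ext f01 y)
    + y i * ((1 - y j) * multilinear_ext f10 y
             + y j * multilinear_ext f11 y).
  rewrite (multilinear_ext_split f y i).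
  by congr (_ * _ + _ * _); rewrite (multilinear_ext_split _ y j).
have const h l : (forall C, h (i |: C) = h C) -> (forall C, h (j |: C) = h C) ->
    multilinear_ext h (shift i j x l) = multilinear_ext h x.
  (* The point [y] has moved in coordinate [i] only, so each comparison changes a single
     coordinate. *)
  move=> hi hj; pose y : vec R E := [ffun e => if e == i then x i + l else x e].
  rewrite (@multilinear_ext_ext_off _ _ h _ y j) //; last first.
    move=> e ej; rewrite [RHS]ffunE; have [->|ei] := eqVneq e i.
      by rewrite shift_src.
    by rewrite shift_other.
  apply: (@multilinear_ext_ext_off _ _ h _ _ i) => // e /negbTE ei.
  by rewrite ffunE ei.
have c00 l : multilinear_ext f00 (shift i j x l) = multilinear_ext f00 x.
  by apply: const => C; congr f; apply/setP => e; rewrite !inE;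
    case: eqP; case: eqP.
have c01 l : multilinear_ext f01 (shift i j x l) = multilinear_ext f01 x.
  by apply: const => C; congr f; apply/setP => e; rewrite !inE;
    case: eqP; case: eqP.
have c10 l : multilinear_ext f10 (shift i j x l) = multilinear_ext f10 x.
  by apply: const => C; congr f; apply/setP => e; rewrite !inE;
    case: eqP; case: eqP.
have c11 l : multilinear_ext f11 (shift i j x l) = multilinear_ext f11 x.
  by apply: const => C; congr f; apply/setP => e; rewrite !inE;
    case: eqP; case: eqP.
pose a00 := multilinear_ext f00 x; pose a01 := multilinear_ext f01 x.
pose a10 := multilinear_ext f10 x; pose a11 := multilinear_ext f11 x.
(* The coefficients of [l] and [l ^+ 2] in [splitE], taken at [x i + l] and [x j - l]. *)
exists ((1 - x j) * (a10 - a00) + x j * (a11 - a01)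
        - (1 - x i) * (a01 - a00) - x i * (a11 - a10),
        a10 + a01 - a00 - a11) => /= [|l]; last first.
  rewrite (splitE (shift i j x l)) (splitE x) shift_src // shift_tgt //.
  by rewrite c00 c01 c10 c11 -/a00 -/a01 -/a10 -/a11; ring.
have <- : multilinear_ext (fun C => f10 C + f01 C - f00 C - f11 C) x
    = a10 + a01 - a00 - a11.
  rewrite /a10 /a01 /a00 /a11 /multilinear_ext -big_split -!sumrB /=.
  by apply: eq_bigr => C _; rewrite !mulrDl !mulNr.
(* Submodularity is applied to [i |: C :\ j] and [(j |: C) :\ i]: their union contains both
   elements, their intersection neither. *)
apply: multilinear_ext_ge0 => // C; rewrite -addrA -opprD subr_ge0 addrC.
rewrite (_ : f11 C = f ((i |: C :\ j) :|: ((j |: C) :\ i))).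
  rewrite (_ : f00 C = f ((i |: C :\ j) :&: ((j |: C) :\ i))).
    exact: fsub.
  rewrite /f00; congr f; apply/setP => e; rewrite !inE.
  have [->|] := eqVneq e i; first by rewrite (negbTE ij).
  by case: (e == j); case: (e \in C).
rewrite /f11; congr f; apply/setP => e; rewrite !inE.
have [->|] := eqVneq e i; first by rewrite (negbTE ij).
by case: (e == j); case: (e \in C).
Qed.

(** The quadratic term is nonnegative for every [l], so it suffices to go to the side on which the
    linear term is nonnegative. *)
Lemma multilinear_ext_shift_ge (R : realType) (E : finType)
    (f : {set E} -> R) (x : vec R E) (i j : E) (lm lp : R) :
  submodular f -> (forall e, 0 <= x e <= 1) -> i != j -> lm < 0 < lp ->
  exists2 l, l = lm \/ l = lp &
    multilinear_ext f x <= multilinear_ext f (shift i j x l).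
Proof.
move=> fsub x01 ij /andP[lm0 lp0].
have [[b c] /= c0 gE] := multilinear_ext_shift fsub x01 ij.
have [b0|b0] := leP 0 b.
  exists lp; first by right.
  by rewrite gE -addrA lerDl addr_ge0 // mulr_ge0 ?sqr_ge0 // ltW.
exists lm; first by left.
rewrite gE -addrA lerDl; apply: addr_ge0; first by rewrite mulr_le0 ?ltW.
by rewrite mulr_ge0 ?sqr_ge0.
Qed.

(** * Partition polytopes and their exchange segments *)

(* The blocks are the fibers of b. *)
Definition partition_polytope (R : realType) (E I : finType) (b : E -> I)
    (B : nat) (c : I -> nat) : set (vec R E) :=
  [set x | [/\ forall e, 0 <= x e <= 1,
               \sum_e x e = B%:R
             & forall r, \sum_(e | b e == r) x e <= (c r)%:R]]%classic.

Definition fractional (R : realType) (E : finType) (x : vec R E) : {set E} :=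
  [set e | 0 < x e < 1].

Lemma integral_coord (R : realType) (E : finType) (x : vec R E) (e : E) :
  0 <= x e <= 1 -> e \notin fractional x -> x e = (x e == 1%R :> R)%:R.
Proof.
move=> /andP[x0 x1]; rewrite inE negb_and -!leNgt => /orP[] h.
  have -> : x e = 0 by apply/le_anti; rewrite h.
  by rewrite [0 == 1]eq_sym oner_eq0.
have -> : x e = 1 by apply/le_anti; rewrite h x1.
by rewrite eqxx.
Qed.

Lemma integral_sum (R : realType) (E : finType) (x : vec R E) (A : pred E) :
  (forall e, 0 <= x e <= 1) -> (forall e, A e -> e \notin fractional x) ->
  exists k : nat, \sum_(e | A e) x e = k%:R.
Proof.
move=> x01 xA; exists (\sum_(e | A e) (x e == 1%R :> R))%N.
rewrite natr_sum; apply: eq_bigr => e /xA; exact: integral_coord.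
Qed.

(* If i is the only fractional coordinate in A, rounding x i up to 1 keeps the
   sum over A below any integer bound. *)
Lemma lone_fractional_sum (R : realType) (E : finType) (x : vec R E)
    (A : pred E) (i : E) (c : nat) :
  (forall e, 0 <= x e <= 1) -> A i -> i \in fractional x ->
  (forall e, A e -> e != i -> e \notin fractional x) ->
  \sum_(e | A e) x e <= c%:R -> \sum_(e | A e) x e + (1 - x i) <= c%:R.
Proof.
move=> x01 Ai; rewrite inE => /andP[xi0 xi1] lone; rewrite (bigD1 i) //=.
have [|k ->] := @integral_sum _ _ x (fun e => A e && (e != i)) x01.
  by move=> e /andP[]; exact: lone.
(* Since [x i] is positive, the integer [k] lies strictly below [c]; hence [k + 1], the sum after
   rounding up, is at most [c]. *)
move=> le_c; have : k%:R < c%:R :> R by apply: lt_le_trans le_c; rewrite ltrDr.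
by rewrite ltr_nat -(ler_nat R) -natr1; apply: le_trans; lra.
Qed.

Lemma shift_sum (R : realType) (E : finType) (x : vec R E) (A : pred E)
    (i j : E) (l : R) :
  \sum_(e | A e) shift i j x l e
    = \sum_(e | A e) x e + l * ((A i)%:R - (A j)%:R).
Proof.
have sum_eq k : \sum_(e | A e) ((e == k)%:R : R) = (A k)%:R.
  rewrite big_mkcond (bigD1 k) //= eqxx big1 => [|e /negbTE->].
    by rewrite addr0; case: (A k).
  by case: (A e).
rewrite (eq_bigr _ (fun e _ => shiftE i j x l e)) big_split /= -big_distrr /=.
by rewrite sumrB !sum_eq.
Qed.

Lemma partition_polytope_pair (R : realType) (E I : finType) (b : E -> I)
    (B : nat) (c : I -> nat) (x : vec R E) (e0 : E) :
  partition_polytope b B c x -> e0 \in fractional x ->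
  exists i j : E, [/\ i != j, i \in fractional x, j \in fractional x
    & forall l, 0 <= x i + l <= 1 -> 0 <= x j - l <= 1 ->
        partition_polytope b B c (shift i j x l)].
Proof.
move=> [x01 xB xc] e0f.
suff [i [j [ij fi fj bij]]] : exists i j : E,
    [/\ i != j, i \in fractional x, j \in fractional x
      & b i = b j \/ forall e e', e \in fractional x -> e' \in fractional x ->
          b e = b e' -> e = e'].
  exists i, j; split=> // l li lj; split=> [e||r].
  - have [->|ei] := eqVneq e i; first by rewrite shift_src.
    have [->|ej] := eqVneq e j; first by rewrite shift_tgt.
    by rewrite shift_other.
  - by rewrite (@shift_sum _ _ x xpredT) subrr mulr0 addr0.
  - rewrite (@shift_sum _ _ x (fun e => b e == r)) /=.
    case: bij => [->|lone]; first by rewrite subrr mulr0 addr0.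
    have le1 k : k \in fractional x -> b k == r ->
        \sum_(e | b e == r) x e + (1 - x k) <= (c r)%:R.
      move=> fk /eqP bk; apply: lone_fractional_sum => //; first exact/eqP.
      move=> e /eqP be; apply: contraNN => fe.
      by apply/eqP/lone; rewrite // be bk.
    have := xc r; have := le1 _ fi; have := le1 _ fj.
    (* If just one of [i], [j] lies in block [r], the block sum grows by at most the distance of
       that coordinate to [1], which is the room granted by [le1]. *)
    case: (b j == r); case: (b i == r) => //=.
    + by rewrite subrr mulr0 addr0.
    + move=> /(_ isT) h _ _; apply: le_trans h.
      by move/andP: lj => [_ lj]; lra.
    + move=> _ /(_ isT) h _; apply: le_trans h.
      by move/andP: li => [_ li]; lra.
    + by rewrite subrr mulr0 addr0.
case: (pselect (exists i j : E,
    [/\ i != j, i \in fractional x, j \in fractional x & b i = b j])).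
  by move=> [i [j [ij fi fj bij]]]; exists i, j; split=> //; left.
move=> none; have lone e e' : e \in fractional x -> e' \in fractional x ->
    b e = b e' -> e = e'.
  move=> fe fe' bee; apply: contrapT => /eqP ee; apply: none.
  by exists e, e'.
have [/existsP[j /andP[je fj]]|] :=
    boolP [exists j, (j != e0) && (j \in fractional x)].
  by exists e0, j; split=> //; [rewrite eq_sym | right].
(* Were [e0] the only fractional coordinate, the total, which equals the integer [B], would still
   leave room [1 - x e0 > 0] below [B]. *)
rewrite negb_exists => /forallP only_e0.
have := @lone_fractional_sum _ _ x xpredT e0 B x01 isT e0f.
rewrite xB lexx => /(_ _ isT); move: e0f; rewrite inE => /andP[_ x1].
move=> h; have : (B%:R + (1 - x e0) <= B%:R :> R).
  by apply: h => e _ ee0; have := only_e0 e; rewrite ee0.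
by lra.
Qed.

(* Along the direction chosen by [partition_polytope_pair] only the constraints
   0 <= x i, x j <= 1 bind. *)
Lemma partition_polytope_segment (R : realType) (E I : finType) (b : E -> I)
    (B : nat) (c : I -> nat) (x : vec R E) (e0 : E) :
  partition_polytope b B c x -> e0 \in fractional x ->
  exists (i j : E) (lm lp : R),
    [/\ i != j, i \in fractional x, j \in fractional x & lm < 0 < lp] /\
    [/\ [set l | partition_polytope b B c (shift i j x l)]%classic
          = `[lm, lp]%classic
      & forall l, l = lm \/ l = lp ->
          (#|fractional (shift i j x l)| < #|fractional x|)%N].
Proof.
move=> Qx fe0; have [x01 _ _] := Qx.
have [i [j [ij fi fj Q_shift]]] := partition_polytope_pair Qx fe0.
(* These bounds solve [0 <= x i + l <= 1] and [0 <= x j - l <= 1]. *)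
exists i, j, (Num.max (- x i) (x j - 1)), (Num.min (1 - x i) (x j)).
have /andP[xi0 xi1] : 0 < x i < 1 by move: fi; rewrite inE.
have /andP[xj0 xj1] : 0 < x j < 1 by move: fj; rewrite inE.
split; [split=> // | split].
- by rewrite gt_max lt_min; apply/andP; split; apply/andP; split; lra.
- apply/seteqP; split => l /=; rewrite in_itv /= ge_max le_min.
    case=> s01 _ _; have := s01 i; have := s01 j.
    rewrite shift_src // shift_tgt // => /andP[? ?] /andP[? ?].
    by apply/andP; split; apply/andP; split; lra.
  move=> /andP[/andP[? ?] /andP[? ?]].
  by apply: Q_shift; apply/andP; split; lra.
- move=> l lE; apply: proper_card; apply/properP.
  have sub : fractional (shift i j x l) \subset fractional x.
    apply/fintype.subsetP => e; have [->|ei] := eqVneq e i; first by rewrite fi.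
    have [->|ej] := eqVneq e j; first by rewrite fj.
    by rewrite !inE shift_other.
  split=> //.
  (* An endpoint attains one of the four cube constraints, which makes coordinate [i] or [j]
     integral. *)
  have : [\/ l = - x i, l = x j - 1, l = 1 - x i | l = x j].
    case: lE => ->.
      by case: (leP (- x i) (x j - 1)) => _; [constructor 2|constructor 1].
    by case: (leP (1 - x i) (x j)) => _; [constructor 3|constructor 4].
  case=> ->.
  + by exists i; rewrite // inE shift_src // subrr ltxx.
  + exists j; rewrite // inE shift_tgt // opprB addrCA subrr addr0.
    by rewrite ltxx andbF.
  + by exists i; rewrite // inE shift_src // addrCA subrr addr0 ltxx andbF.
  + by exists j; rewrite // inE shift_tgt // subrr ltxx.
Qed.

Lemma partition_polytope_integral (R : realType) (E I : finType) (b : E -> I)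
    (B : nat) (c : I -> nat) (x : vec R E) :
  partition_polytope b B c x -> fractional x = finset.set0 ->
  exists2 C : {set E}, x = incidence R C
    & #|C| = B /\ forall r, (#|[set e in C | b e == r]| <= c r)%N.
Proof.
move=> [x01 xB xc] frac0.
have xE : x = incidence R [set e | x e == 1%R :> R].
  apply/ffunP => e; rewrite ffunE inE.
  by apply: integral_coord; rewrite // frac0 inE.
have sumE (A : pred E) : \sum_(e | A e) x e
    = #|[set e in [set e | x e == 1%R :> R] | A e]|%:R.
  rewrite -sum1_card natr_sum [in LHS]xE [RHS]big_mkcond [LHS]big_mkcond /=.
  by apply: eq_bigr => e _; rewrite ffunE !inE; case: (x e == 1); case: (A e).
exists [set e | x e == 1%R :> R] => //; split=> [|r].
  apply/eqP; rewrite -(eqr_nat R) -xB (sumE xpredT); apply/eqP; congr (_%:R).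
  by apply: eq_card => e; rewrite !inE andbT.
by rewrite -(ler_nat R) -sumE.
Qed.

Lemma incidence_partition_polytope (R : realType) (E I : finType) (b : E -> I)
    (B : nat) (c : I -> nat) (C : {set E}) :
  #|C| = B -> (forall r, #|[set e in C | b e == r]| <= c r)%N ->
  partition_polytope b B c (incidence R C).
Proof.
have sumE (A : pred E) : \sum_(e | A e) incidence R C e
    = #|[set e in C | A e]|%:R.
  rewrite -sum1_card natr_sum [RHS]big_mkcond [LHS]big_mkcond /=.
  by apply: eq_bigr => e _; rewrite ffunE !inE; case: (e \in C); case: (A e).
move=> CB Cc; split=> [e||r].
- by rewrite ffunE; case: (e \in C); rewrite /= ?lexx ler01.
- rewrite (sumE xpredT) -CB; congr (_%:R).
  by apply: eq_card => e; rewrite !inE andbT.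
- by rewrite sumE ler_nat.
Qed.

(** The index type is arbitrary so as to serve twice: [bool] gives convexity of the polytope, ['I_m]
    the starting point of the rounding. *)
Lemma partition_polytope_sum (R : realType) (E I T : finType) (b : E -> I)
    (B : nat) (c : I -> nat) (s : T -> R) (y : T -> vec R E) :
  (forall t, 0 <= s t) -> \sum_t s t = 1 ->
  (forall t, partition_polytope b B c (y t)) ->
  partition_polytope b B c (\sum_t s t *: y t).
Proof.
move=> s0 s1 yQ.
have sumE (A : pred E) : \sum_(e | A e) (\sum_t s t *: y t) e
    = \sum_t s t * \sum_(e | A e) y t e.
  under eq_bigr do rewrite sum_ffunE.
  rewrite exchange_big /=; apply: eq_bigr => t _.
  by rewrite big_distrr; apply: eq_bigr => e _; rewrite ffunE.
split=> [e||r].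
- rewrite sum_ffunE; apply/andP; split.
    apply: sumr_ge0 => t _; rewrite ffunE mulr_ge0 //.
    by have [/(_ e)/andP[]] := yQ t.
  rewrite -s1; apply: ler_sum => t _; rewrite ffunE ler_piMr //.
  by have [/(_ e)/andP[]] := yQ t.
- rewrite (sumE xpredT) (eq_bigr (fun t => s t * B%:R)).
    by rewrite -big_distrl /= s1 mul1r.
  by move=> t _; have [_ ->] := yQ t.
- rewrite sumE; apply: (@le_trans _ _ (\sum_t s t * (c r)%:R)).
    by apply: ler_sum => t _; rewrite ler_wpM2l //; have [_ _] := yQ t.
  by rewrite -big_distrl /= s1 mul1r.
Qed.

(** * The hull of the bases is the partition polytope *)

Lemma convex_hull_segment (R : realType) (V : lmodType R) (A : set V)
    (a b : V) (t : R) :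
  0 <= t <= 1 -> convex_hull A a -> convex_hull A b ->
  convex_hull A (t *: a + (1 - t) *: b).
Proof.
move=> /andP[t0 t1] aA bA Y [/= Yconv AY]; apply/set_mem.
by apply: (Yconv a b (Itv01 t0 t1)); apply/mem_set; [exact: aA | exact: bA].
Qed.

(** One inclusion is minimality of the hull. For the other, a non-integral point lies between the
    two ends of its exchange segment, to which the induction applies. *)
Lemma partition_polytope_hull (R : realType) (E I : finType) (b : E -> I)
    (B : nat) (c : I -> nat) (D : {set {set E}}) :
  (forall C, C \in D <->
     #|C| = B /\ forall r, (#|[set e in C | b e == r]| <= c r)%N) ->
  convex_hull [set incidence R C | C in [set` D]]%classic
    = partition_polytope b B c.
Proof.
move=> DE; apply/seteqP; split.
  apply: smallest_sub => [x y l /set_mem xQ /set_mem yQ|_ [C /= /DE[CB Cc] <-]].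
    apply/mem_set.
    have := @partition_polytope_sum R E I bool b B c
      (fun t => if t then l%:num else 1 - l%:num) (fun t => if t then x else y).
    rewrite !big_bool /=; apply=> [[]||[]] //; last by rewrite addrC subrK.
  exact: incidence_partition_polytope.
move=> x; have [k] := ubnP #|fractional x|; elim: k x => // k IH x lek Qx.
have [frac0|[e0 fe0]] := set_0Vmem (fractional x).
  have [C -> CD] := partition_polytope_integral Qx frac0.
  by apply: sub_gen_smallest; exists C => //; apply/DE.
have [i [j [lm [lp [[ij fi fj /andP[lm0 lp0]] [segE ltfrac]]]]]] :=
  partition_polytope_segment Qx fe0.
have ends l : l = lm \/ l = lp ->
    convex_hull [set incidence R C | C in [set` D]]%classic (shift i j x l).
  move=> lE; apply: IH; first exact: leq_trans (ltfrac l lE) lek.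
  have : `[lm, lp]%classic l.
    by rewrite /= in_itv /=; case: lE => ->; rewrite lexx ltW // (lt_trans lm0).
  by rewrite -segE.
have d0 : 0 < lp - lm by rewrite subr_gt0 (lt_trans lm0).
(* The weights are proportional to [lp] and [- lm], so that the two offsets cancel. *)
have -> : x = (lp / (lp - lm)) *: shift i j x lm
            + (1 - lp / (lp - lm)) *: shift i j x lp.
  apply/ffunP => e; rewrite [RHS]ffunE [X in X + _]ffunE [X in _ + X]ffunE.
  rewrite !shiftE /GRing.scale /=; field.
  exact: lt0r_neq0.
apply: convex_hull_segment; [|by apply: ends; left|by apply: ends; right].
apply/andP; split; first by rewrite divr_ge0 ?ltW.
by rewrite ler_pdivrMr // mul1r lerDl oppr_ge0 ltW.
Qed.

(** * Pipage rounding of a submodular function *)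

Lemma pipage_rounding (R : realType) (E I : finType) (b : E -> I)
    (B : nat) (c : I -> nat) (D : {set {set E}}) (f : {set E} -> R)
    (x : vec R E) :
  let P := convex_hull [set incidence R C | C in [set` D]]%classic in
  (forall C, C \in D <->
     #|C| = B /\ forall r, (#|[set e in C | b e == r]| <= c r)%N) ->
  submodular f -> P x ->
  exists (C0 : {set E}) (T : nat) (y : nat -> vec R E),
    [/\ C0 \in D, y 0%N = x,
        forall k, (k < T)%N -> pipage_move P (y k) (y k.+1),
        y T = incidence R C0
      & multilinear_ext f x <= f C0].
Proof.
(* With the hull given by inequalities, the feasible [l] form exactly the interval of
   [partition_polytope_segment], as a move requires. *)
move=> P DE fsub; rewrite /P (partition_polytope_hull R DE).
have [k] := ubnP #|fractional x|; elim: k x => // k IH x lek Qx.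
have [frac0|[e0 fe0]] := set_0Vmem (fractional x).
  have [C -> CD] := partition_polytope_integral Qx frac0.
  exists C, 0%N, (fun=> incidence R C); split=> //; first exact/DE.
  by rewrite multilinear_ext_incidence.
have [i [j [lm [lp [[ij fi fj lmp] [segE ltfrac]]]]]] :=
  partition_polytope_segment Qx fe0.
have [x01 _ _] := Qx.
have [l lE le_f] := multilinear_ext_shift_ge fsub x01 ij lmp.
have Ql : partition_polytope b B c (shift i j x l).
  have : `[lm, lp]%classic l.
    move/andP: lmp => [lm0 lp0].
    by rewrite /= in_itv /=; case: lE => ->; rewrite lexx ltW // (lt_trans lm0).
  by rewrite -segE.
have [C0 [T [y [C0D y0 ymove yT leC0]]]] :=
  IH _ (leq_trans (ltfrac l lE) lek) Ql.
(* The move from [x] to the chosen endpoint is put in front of the sequence given by induction. *)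
exists C0, T.+1, (fun k => if k is k'.+1 then y k' else x); split=> //.
  case=> [_|k' /ymove //]; rewrite y0; split=> //.
  exists i, j, lm, lp; split; first by move: fi fj; rewrite !inE.
  by split=> //; exists l.
exact: le_trans le_f leC0.
Qed.

(** * Frame potentials and submodularity of the value *)

Lemma frame_potential_ge0 (R : realType) (N K : nat) (U : 'M[R]_(N, K))
    (S : {set 'I_N}) : 0 <= frame_potential U S.
Proof. by do 2![apply: sumr_ge0 => ? _]; exact: sqr_ge0. Qed.

(** Summing over all pairs with an indicator reduces inequalities between potentials to inequalities
    between indicators, weighted by squares. *)
Lemma frame_potentialE (R : realType) (N K : nat) (U : 'M[R]_(N, K))
    (S : {set 'I_N}) :
  frame_potential U S = \sum_i \sum_j
    ((row i U *m (row j U)^T) 0 0) ^+ 2 * ((i \in S) && (j \in S))%:R.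
Proof.
rewrite /frame_potential big_mkcond; apply: eq_bigr => i _.
case: (i \in S) => /=; last by rewrite big1 // => j _; rewrite mulr0.
rewrite big_mkcond; apply: eq_bigr => j _.
by case: (j \in S); rewrite ?mulr1 ?mulr0.
Qed.

Lemma frame_potential_mono (R : realType) (N K : nat) (U : 'M[R]_(N, K))
    (S T : {set 'I_N}) :
  S \subset T -> frame_potential U S <= frame_potential U T.
Proof.
move=> ST; rewrite !frame_potentialE; apply: ler_sum => i _.
apply: ler_sum => j _; rewrite ler_wpM2l ?sqr_ge0 // ler_nat.
have := fintype.subsetP ST i; have := fintype.subsetP ST j.
case: (i \in S) => //=; case: (j \in S) => //=.
by do 2![move=> /(_ isT)->].
Qed.

(** For each pair, the indicator that both indices lie in the set is supermodular, as the sixteen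
    membership patterns show. *)
Lemma frame_potential_supermodular (R : realType) (N K : nat)
    (U : 'M[R]_(N, K)) (S T : {set 'I_N}) :
  frame_potential U S + frame_potential U T
    <= frame_potential U (S :|: T) + frame_potential U (S :&: T).
Proof.
rewrite !frame_potentialE -!big_split; apply: ler_sum => i _ /=.
rewrite -!big_split; apply: ler_sum => j _ /=; rewrite -!mulrDr.
rewrite ler_wpM2l ?sqr_ge0 // -!natrD ler_nat !inE.
by case: (i \in S); case: (i \in T); case: (j \in S); case: (j \in T).
Qed.

(* u, a, b, d are the values at S :|: T, S, T and S :&: T of a nonnegative
   monotone supermodular function. *)
Definition supermodular_values (R : realType) (u a b d : R) :=
  [/\ 0 <= d, d <= a <= u, d <= b <= u & a + b <= u + d].

(** Supermodularity alone does not survive products; nonnegativity and monotonicity give the mixed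
    terms their sign. *)
Lemma supermodular_valuesM (R : realType) (u a b d u' a' b' d' : R) :
  supermodular_values u a b d -> supermodular_values u' a' b' d' ->
  supermodular_values (u * u') (a * a') (b * b') (d * d').
Proof.
move=> [d0 /andP[da au] /andP[db bu] s] [d0' /andP[da' au'] /andP[db' bu'] s'].
split; [exact: mulr_ge0 | | |].
- by apply/andP; split; apply: ler_pM => //; lra.
- by apply/andP; split; apply: ler_pM => //; lra.
(* The defect of the product is a sum of four products, all of whose factors are nonnegative. *)
- rewrite -subr_ge0 (_ : _ - _ =
    (a - d) * (b' - d') + (b - d) * (a' - d') + (u + d - (a + b)) * u'
    + (a + (b - d)) * (u' + d' - (a' + b'))); last by ring.
  do 3![apply: addr_ge0; last by apply: mulr_ge0; lra].
  by apply: mulr_ge0; lra.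
Qed.

Lemma supermodular_values_prod (R : realType) (n : nat) (u a b d : 'I_n -> R) :
  (forall r, supermodular_values (u r) (a r) (b r) (d r)) ->
  supermodular_values (\prod_r u r) (\prod_r a r) (\prod_r b r) (\prod_r d r).
Proof.
move=> h; elim: (index_enum _) => [|r s IH].
  by rewrite !big_nil; split=> //; rewrite ?ler01 ?lexx.
by rewrite !big_cons; exact: supermodular_valuesM.
Qed.

(** Complementation swaps union and intersection, and subtraction from [1] turns the supermodular
    product into a submodular function. *)
Lemma value_submodular (R : realType) (n : nat) (N K : 'I_n -> nat)
    (U : forall r, 'M[R]_(N r, K r)) : submodular (value U).
Proof.
move=> A B; rewrite /value; set Z := \prod_(r < n) frame_potential _ [set: _].
have /supermodular_values_prod[_ _ _] : forall r, supermodular_values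
    (frame_potential (U r) (~: block (A :&: B) r))
    (frame_potential (U r) (~: block A r))
    (frame_potential (U r) (~: block B r))
    (frame_potential (U r) (~: block (A :|: B) r)).
  move=> r.
  have -> : block (A :&: B) r = block A r :&: block B r.
    by apply/setP => i; rewrite !inE.
  have -> : block (A :|: B) r = block A r :|: block B r.
    by apply/setP => i; rewrite !inE.
  rewrite finset.setCI finset.setCU; split; first exact: frame_potential_ge0.
  - by rewrite !frame_potential_mono ?finset.subsetIl ?finset.subsetUl.
  - by rewrite !frame_potential_mono ?finset.subsetIr ?finset.subsetUr.
  - exact: frame_potential_supermodular.
set u := \prod_(r < n) _ (~: block (A :&: B) r).
set d := \prod_(r < n) _ (~: block (A :|: B) r).
set a := \prod_(r < n) _; set b := \prod_(r < n) _ => abud.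
(* This covers [Z = 0] as well, the inverse of [0] being [0]. *)
have Z0 : 0 <= Z^-1.
  by rewrite invr_ge0; apply: prodr_ge0 => r _; exact: frame_potential_ge0.
by have := ler_wpM2r Z0 abud; rewrite !mulrDl; lra.
Qed.

(** * Bases as sets with bounded fibers of [tag], and the conclusion *)

Lemma card_block (n : nat) (N : 'I_n -> nat) (C : {set ground N}) (r : 'I_n) :
  #|block C r| = #|[set e in C | tag e == r]|.
Proof.
have <- : Tagged (fun s => 'I_(N s)) @: block C r = [set e in C | tag e == r].
  apply/setP => e; apply/imsetP/idP => [[i]|].
    by rewrite !inE => iC ->; rewrite iC eqxx.
  case: e => r' i; rewrite inE /= => /andP[eC /eqP rr']; subst r'.
  by exists i; rewrite ?inE.
by rewrite card_imset // => i j /eqP; rewrite eq_Tagged => /eqP.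
Qed.

(** This is the description of [D] that [pipage_rounding] asks for, with [tag] as the block map. *)
Lemma basesP (n : nat) (N kappa : 'I_n -> nat) (L : nat) (C : {set ground N}) :
  C \in bases N kappa L <-> #|C| = ((\sum_(r < n) N r) - L)%N
    /\ forall r, (#|[set e in C | tag e == r]| <= N r - kappa r)%N.
Proof.
rewrite inE; split=> [/andP[/eqP CB /forallP Cc]|[CB Cc]].
  by split=> // r; rewrite -card_block.
by rewrite CB eqxx; apply/forallP => r; rewrite card_block.
Qed.

Theorem lemma8 (R : realType) (n : nat) (N K : 'I_n -> nat)
    (U : forall r : 'I_n, 'M[R]_(N r, K r))
    (kappa : 'I_n -> nat) (L : nat)
    (m : nat) (s : 'I_m -> R) (C : 'I_m -> {set ground N})
    (xT : vec R (ground N)) :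
  (1 <= n)%N ->
  (forall r : 'I_n, \rank (U r) = K r) ->
  (forall r : 'I_n, (K r <= kappa r <= N r)%N) ->
  (\sum_(r < n) kappa r <= L <= \sum_(r < n) N r)%N ->
  (forall t : 'I_m, C t \in bases N kappa L) ->
  (forall t : 'I_m, 0 <= s t) ->
  \sum_(t < m) s t = 1 ->
  xT = \sum_(t < m) s t *: incidence R (C t) ->
  exists (C0 : {set ground N}) (T : nat) (x : nat -> vec R (ground N)),
    [/\ C0 \in bases N kappa L,
        x 0%N = xT,
        forall k : nat, (k < T)%N ->
          pipage_move (base_polytope R N kappa L) (x k) (x k.+1),
        x T = incidence R C0
      & value U C0 >= multilinear_ext (value U) xT].
Proof.
move=> _ _ _ _ Cbase s0 s1 xTE.
apply: (pipage_rounding (@basesP n N kappa L)); first exact: value_submodular.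
rewrite (partition_polytope_hull R (@basesP n N kappa L)) xTE.
apply: partition_polytope_sum => // t.
by apply: incidence_partition_polytope; have /basesP[] := Cbase t.
Qed.
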